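(* Let $n\ge 0$ be an integer and let $s$ be an integer with $\frac38 n\le s\le \frac25 n$. Then \[ \mathrm{ex}(n,s)=3n^2-15ns+20s^2. \] Consequently, \[ f(\alpha)=6-30\alpha+40\alpha^2\quad\text{for every }\alpha\in\left[\tfrac38,\tfrac25\right]. \]
   Context: For integers $n\ge s\ge 0$, $\mathrm{ex}(n,s)$ denotes the maximum number of edges in a triangle-free graph on $n$ vertices with independence number $\alpha(G)\le s$. The Ramsey–Turán density function $f\colon(0,1]\to\mathbb{R}$ is defined by $f(\alpha)=\lim_{n\to\infty}\mathrm{ex}(n,\alpha n)/\binom n2$ (this limit exists). *)

(* Defs.v *)
From HB Require Import structures.
From mathcomp Require Import all_boot all_order all_algebra.
From mathcomp Require Import all_classical all_reals all_analysis.
Set Implicit Arguments.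
Unset Strict Implicit.
Unset Printing Implicit Defensive.
Import Order.TTheory GRing.Theory Num.Theory.
Import numFieldNormedType.Exports.

(* A graph on the vertex set T is given by its set E of edges, each edge being
   the two-element set of its endpoints. *)
Definition is_graph (T : finType) (E : {set {set T}}) : bool :=
  [forall e in E, #|e| == 2].

(* Irreflexive when [is_graph E], since [set x; x] has one element; hence the
   definitions below need no distinctness conditions. *)
Definition adj (T : finType) (E : {set {set T}}) (x y : T) : bool :=
  [set x; y] \in E.

Definition triangle_free (T : finType) (E : {set {set T}}) : bool :=
  ~~ [exists x, exists y, exists z, [&& adj E x y, adj E y z & adj E x z]].

Definition independent (T : finType) (E : {set {set T}}) (A : {set T}) : bool :=
  [forall x in A, forall y in A, ~~ adj E x y].

Definition independence_number (T : finType) (E : {set {set T}}) : nat :=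
  \max_(A : {set T} | independent E A) #|A|.

(* The maximum is 0 by convention when no such graph exists. *)
Definition ex (n s : nat) : nat :=
  \max_(E : {set {set 'I_n}} |
      [&& is_graph E, triangle_free E & independence_number E <= s]) #|E|.

Local Open Scope ring_scope.
Local Open Scope classical_set_scope.

(* The independence number is an integer, so bounding it by a * n amounts to
   bounding it by the integer part of a * n (here a >= 0). *)
Definition RT_ratio (R : realType) (a : R) (n : nat) : R :=
  (ex n (Num.truncn (a * n%:R)))%:R / 'C(n, 2)%:R.

(* Only meaningful for 0 < a <= 1. *)
Definition RT_density (R : realType) (a : R) : R :=
  limn (RT_ratio a).

(* Main.v *)
(* Put p = 3s - n and q = 2n - 5s, so that n = 5p + 3q, s = 2p + q and the claimed
   value is 5p^2 + 5pq + 2q^2. The range of s is 0 <= q <= p.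

   Upper bound, by induction. If p <= q, or if no independent set has size s, degrees
   are at most s and the bound is trivial or reduces to (p - 3, q + 5). Otherwise call an
   independent set of size s an s-set. If A is an s-set and b lies in every s-set
   disjoint from A, then giving b the neighbourhood A keeps the graph triangle-free with
   independence number s and loses no edges. A Hall-type exchange argument shows that
   this can be repeated p times. It produces twin classes of size p for two disjoint
   s-sets S0 and S1. If some edge between the two classes meets every s-set, delete its
   two ends: this loses at most 2s - 1 edges and leads to (p - 1, q + 1). If not, an
   s-set avoids both classes, and conversion yields four twin classes of size p on a
   path. Counting edges inside these 4p vertices, between them and the other p + 3q
   vertices, and inside the latter gives the bound.

   Lower bound: the blow-up of the Wagner graph (Z/8, differences 3, 4, 5) with weights
   p, p, q, p, p, q, p, q.

   Limit: for a > 3/8 the formula applies to all large n. At a = 3/8 the integer part of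
   3n/8 may lie outside the range; there the degree bound ns/2 is the upper bound, and
   the lower bound is a union of two blow-ups. *)

Require Import Defs.
From HB Require Import structures.
From mathcomp Require Import all_boot.
From mathcomp Require Import boolp.
From mathcomp Require Import zify.
Set Implicit Arguments.
Unset Strict Implicit.
Unset Printing Implicit Defensive.

(** For the adjacent pairs outside the four classes of [path_count]: [r = #|R2|], [w = #|Om|], and
    [k] is the independence number of [Om]. If [w = 2 * q + h] with [h > 0], then
    [4 * (k * t) <= w * w] leaves an excess of at most [h * h / 2]. The term [2 * p * phi] absorbs
    it, since [h <= phi] and [h <= p + q <= 2 * p]. *)
Lemma path_arith p q r w k t phi : q <= p -> r + w = p + 3 * q -> w <= 2 * q + phi ->
  w = k + t ->
  r * (q + minn k q) + 2 * (k * t) <= 2 * p * q + 4 * q * q + 2 * p * phi.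
Proof.
move=> qp hr hw hk.
have [w2|w2] := leqP w (2 * q).
  apply: (@leq_trans (2 * p * q + 4 * q * q)); last exact: leq_addr.
  have [qk|kq] := leqP q k.
    have [a ka] : exists a, k = q + a by exists (k - q); lia.
    have [b qb] : exists b, q = t + b by exists (q - t); lia.
    have hr' : r + a = p + q + b by lia.
    have e1 : r * (2 * q) + a * (2 * q) = (p + q + b) * (2 * q).
      by rewrite -mulnDl hr'.
    have e2 : q * t + q * b = q * q by rewrite -mulnDr -qb.
    have e3 : a * t + a * b = a * q by rewrite -mulnDr -qb.
    by subst k; nia.
  have [y qy] : exists y, q = k + y by exists (q - k); lia.
  have hr' : r + t = p + 2 * k + 3 * y by lia.
  have e1 : r * (2 * k + y) + t * (2 * k + y) = (p + 2 * k + 3 * y) * (2 * k + y).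
    by rewrite -mulnDl hr'.
  by subst q; nia.
have [h wh] : exists h, w = 2 * q + h by exists (w - 2 * q); lia.
have hphi : h <= phi by lia.
have hk4 : 4 * (k * t) <= w * w by rewrite hk mulnn; apply: (nat_AGM2 k t).1.
have h1 : r * (q + minn k q) <= r * (2 * q) by rewrite leq_mul2l; lia.
have hh : h <= 2 * p by lia.
have h2 : 2 * p * h <= 2 * p * phi by rewrite leq_mul2l hphi orbT.
have h3 : h * h <= 2 * p * h by rewrite leq_mul2r hh orbT.
have h4 : r * (2 * q) + h * (2 * q) = (p + q) * (2 * q).
  by rewrite -mulnDl; congr (_ * _); lia.
have h5 : w * w = 4 * q * q + 4 * q * h + h * h by subst w; lia.
lia.
Qed.
Ltac clear_nonarith :=
  repeat match goal with
  | H : ?P |- _ =>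
    lazymatch P with
    | is_true (leq _ _) => fail
    | @eq ?A _ _ => tryif unify A nat then fail else clear H
    | _ => clear H
    end
  end.
Ltac cardlia := intros; clear_nonarith; lia.

(** * Triangle-free graphs with bounded independence number *)

Section Graphs.
Variable T : finType.
Implicit Types (e : rel T) (x y z b : T) (A B D K S U W Z I N : {set T}).

Definition nb e x : {set T} := [set y | e x y].

Definition indep e S : bool := [forall x in S, forall y in S, ~~ e x y].

(** Twice the number of edges. *)
Definition vol e : nat := \sum_x #|nb e x|.

(** Irreflexivity is the case [x = y = z] of [good_tri]. *)
Record good e (s : nat) : Prop := Good {
  good_sym : symmetric e;
  good_tri : forall x y z, e x y -> e y z -> ~~ e x z;
  good_ind : forall S, indep e S -> #|S| <= s }.

Lemma in_nb e x y : (y \in nb e x) = e x y.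
Proof. by rewrite inE. Qed.

Lemma indepP e S :
  reflect (forall x y, x \in S -> y \in S -> ~~ e x y) (indep e S).
Proof.
apply: (iffP forall_inP) => [h x y xS yS|h x xS].
  by have /forall_inP := h x xS; apply.
by apply/forall_inP => y; apply: h.
Qed.

Lemma indep_sub e S S' : S' \subset S -> indep e S -> indep e S'.
Proof.
move=> /subsetP sub /indepP h; apply/indepP => x y /sub xS /sub yS.
exact: h.
Qed.

Lemma indepU e S S' : symmetric e -> indep e S -> indep e S' ->
  (forall x y, x \in S -> y \in S' -> ~~ e x y) -> indep e (S :|: S').
Proof.
move=> sym /indepP h /indepP h' hh; apply/indepP => x y.
rewrite !inE => /orP[xS|xS] /orP[yS|yS]; [exact: h|exact: hh| |exact: h'].
by rewrite sym; apply: hh.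
Qed.

Lemma subset_of_card S k : k <= #|S| -> exists2 S' : {set T}, S' \subset S & #|S'| = k.
Proof.
elim: k => [|k IH] hk; first by exists set0; rewrite ?sub0set ?cards0.
have [S' sub cS'] := IH (ltnW hk).
have /card_gt0P[x] : 0 < #|S :\: S'|.
  by rewrite cardsD (setIidPr sub) cS' subn_gt0.
rewrite inE => /andP[xS' xS]; exists (x |: S').
  by apply/subsetP => y; rewrite !inE => /orP[/eqP->//|/(subsetP sub)].
by rewrite cardsU1 xS' cS'.
Qed.

Lemma cardsDI A B : #|A| = #|A :&: B| + #|A :\: B|.
Proof. by rewrite cardsID. Qed.

Lemma card_disjU A B : [disjoint A & B] -> #|A :|: B| = #|A| + #|B|.
Proof. by move=> d; rewrite cardsU disjoint_setI0 // cards0 subn0. Qed.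

Section Good.
Variables (e : rel T) (s : nat).
Hypothesis ge : good e s.
Let sym := good_sym ge.
Let tri := good_tri ge.
Let ind := good_ind ge.

Lemma good_irr x : e x x = false.
Proof. by apply/negP => h; have := tri h h; rewrite h. Qed.

Lemma indep_nb x : indep e (nb e x).
Proof.
apply/indepP => y z; rewrite !in_nb => xy xz.
by apply/negP => yz; have := tri xy yz; rewrite xz.
Qed.

Lemma deg_le x : #|nb e x| <= s.
Proof. exact/ind/indep_nb. Qed.

Lemma nb_notin x : x \notin nb e x.
Proof. by rewrite in_nb good_irr. Qed.

Lemma vol_le : vol e <= #|T| * s.
Proof.
rewrite /vol (leq_trans (n := \sum_(x : T) s)) ?leq_sum //.
  by move=> x _; apply: deg_le.
by rewrite sum_nat_const.
Qed.

(** Otherwise [x |: S] would be independent with [s + 1] elements. *)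
Lemma max_indep_nb S x : indep e S -> #|S| = s -> [disjoint S & nb e x] -> x \in S.
Proof.
move=> iS cS dS; apply/negPn/negP => xS.
have iS' : indep e (x |: S).
  apply: indepU => //.
    by apply/indepP => y z; rewrite !inE => /eqP-> /eqP->; rewrite good_irr.
  move=> y z; rewrite inE => /eqP-> zS.
  by have := disjointFr dS zS; rewrite in_nb => ->.
by have := ind iS'; rewrite cardsU1 xS cS add1n ltnn.
Qed.

Lemma indep_disj_nb S x : indep e S -> x \in S -> [disjoint S & nb e x].
Proof.
move=> /indepP iS xS; rewrite disjoint_subset; apply/subsetP => y yS.
by rewrite !inE iS.
Qed.

(** Exchanging the neighbours of [I] in [S] for [I] gives an independent set again, of size at most
    [s]. *)
Lemma hall_swap S I : indep e S -> #|S| = s -> indep e I -> [disjoint I & S] ->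
  #|I| <= #|S :&: [set y | [exists x in I, e x y]]|.
Proof.
move=> iS cS iI dIS; set M := [set y | _].
have iJ : indep e (I :|: (S :\: M)).
  apply: indepU => //; first exact: indep_sub (subsetDl _ _) iS.
  move=> x y xI; rewrite !inE => /andP[/existsPn/(_ x)]; by rewrite xI.
have := ind iJ; rewrite card_disjU; last first.
  by apply: disjointWr dIS; apply: subsetDl.
by have := cardsDI S M; rewrite cS; cardlia.
Qed.

End Good.

(* A minimal independent I in U with fewer neighbours in U than elements lies in
   every maximum independent S. Otherwise, by minimality I :&: S has at least as
   many neighbours as elements; by exchange I :\: S has at least as many neighbours
   inside S as elements; and the two sets of neighbours are disjoint. *)
Lemma core_exists e U a : symmetric e ->
  (forall S, S \subset U -> indep e S -> #|S| <= a) ->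
  (exists S : {set T}, [/\ S \subset U, indep e S & #|S| = a]) ->
  #|U| < 2 * a ->
  exists2 b, b \in U &
    forall S, S \subset U -> indep e S -> #|S| = a -> b \in S.
Proof.
move=> sym mx [S0 [S0U iS0 cS0]] cU.
pose NU I := [set y in U | [exists x in I, e x y]].
pose P I := [&& I \subset U, indep e I & #|NU I| < #|I|].
(* The neighbours of [S0] in [U] lie in [U :\: S0], which has fewer than [a] elements. *)
have PS0 : P S0.
  rewrite /P S0U iS0 /=; apply: (@leq_ltn_trans #|U :\: S0|).
    apply: subset_leq_card; apply/subsetP => y; rewrite !inE.
    move=> /andP[yU /exists_inP[x xS xy]]; rewrite yU andbT.
    by apply/negP => yS; have /indepP/(_ x y xS yS) := iS0; rewrite xy.
  have := cardsDI U S0; rewrite (setIidPr S0U); cardlia.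
have [I /minsetP[/and3P[IU iI cI] minI] _] := minset_exists PS0.
have allI S : S \subset U -> indep e S -> #|S| = a -> I \subset S.
  move=> SU iS cS; apply/negPn/negP => nsub.
  pose J := I :&: S; pose L := I :\: S.
  have JI : J \subset I by apply: subsetIl.
  have cJ : #|J| <= #|NU J|.
    rewrite leqNgt; apply/negP => h.
    have JeI : J = I.
      apply: minI => //; rewrite /P h (subset_trans JI IU) andbT /=.
      exact: indep_sub JI iI.
    by case/negP: nsub; rewrite -JeI subsetIr.
  pose M := S :&: NU L.
  have cL : #|L| <= #|M|.
    have iQ : indep e (L :|: (S :\: M)).
      apply: indepU => //.
      - exact: indep_sub (subsetDl _ _) iI.
      - exact: indep_sub (subsetDl _ _) iS.
      move=> x y xL; rewrite !inE => /andP[h yS]; apply/negP => xy.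
      move/negP: h; apply; rewrite yS (subsetP SU) //=.
      by apply/exists_inP; exists x.
    have := mx _ _ iQ; rewrite card_disjU; last first.
      rewrite disjoint_subset; apply/subsetP => y; rewrite !inE.
      by move=> /andP[/negbTE-> _]; rewrite andbF.
    have QU : L :|: S :\: M \subset U.
      rewrite subUset (subset_trans (subsetDl _ _) IU).
      by rewrite (subset_trans (subsetDl _ _) SU).
    move=> /(_ QU); have := cardsDI S M.
    have -> : S :&: M = M by apply/setIidPr; apply: subsetIl.
    rewrite cS; cardlia.
  have dJM : [disjoint NU J & M].
    rewrite disjoint_subset; apply/subsetP => y; rewrite !inE.
    move=> /andP[_ /exists_inP[x]]; rewrite inE => /andP[xI xS] xy.
    rewrite !negb_and; apply/orP; left; apply/negP => yS.
    by have /indepP/(_ x y xS yS) := iS; rewrite xy.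
  have sub : NU J :|: M \subset NU I.
    rewrite subUset; apply/andP; split.
      apply/subsetP => y; rewrite !inE => /andP[-> /exists_inP[x xJ xy]] /=.
      by apply/exists_inP; exists x => //; apply: (subsetP JI).
    apply/subsetP => y; rewrite !inE => /and3P[_ -> /exists_inP[x xL xy]] /=.
    by apply/exists_inP; exists x => //; move: xL; rewrite inE => /andP[].
  have := subset_leq_card sub; rewrite card_disjU //.
  have := cardsDI I S; rewrite -/J -/L; move: cI; cardlia.
have /card_gt0P[b bI] : 0 < #|I| by apply: leq_ltn_trans cI.
exists b; first exact: (subsetP IU).
by move=> S SU iS cS; apply: (subsetP (allI S SU iS cS)).
Qed.

(** * Turning vertices into twins of a maximum independent set *)

(** With [A] and [K] disjoint and [e] symmetric, the result is symmetric and [K] is an independent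
    class of twins with neighbourhood [A]. *)
Definition twin e A K : rel T := fun x y =>
  if x \in K then y \in A else if y \in K then x \in A else e x y.

(** Isolates the contribution of [b]; the double sum is unaffected by a change of its
    neighbourhood. *)
Lemma vol_split e b : symmetric e -> ~~ e b b ->
  vol e = 2 * #|nb e b| + \sum_(x | x != b) \sum_(y | y != b) (e x y : nat).
Proof.
move=> sym irr.
have cnb x : #|nb e x| = \sum_y (e x y : nat).
  by rewrite -sum1dep_card big_mkcond.
have cnb' x : #|nb e x| = e x b + \sum_(y | y != b) (e x y : nat).
  by rewrite cnb (bigD1 b).
rewrite /vol (bigD1 b) //= (eq_bigr (fun x => e x b + \sum_(y | y != b) (e x y : nat))) //.
rewrite big_split /= addnA; congr (_ + _).
rewrite mul2n -addnn; congr (_ + _).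
rewrite (cnb' b) (negbTE irr) add0n; apply: eq_bigr => x _.
by rewrite sym.
Qed.

Lemma vol_le_twin1 e s A b : good e s -> #|A| = s -> b \notin A ->
  vol e <= vol (twin e A [set b]).
Proof.
move=> ge cA bA; have sym := good_sym ge.
rewrite (vol_split (b := b)) ?(good_irr ge) //.
rewrite (@vol_split (twin e A [set b]) b); last 2 first.
- move=> x y; rewrite /twin !inE; case: eqP => [->|_].
    by case: eqP => [->|].
  by case: eqP => // _; rewrite sym.
- by rewrite /twin !inE eqxx.
apply: leq_add.
  rewrite leq_pmul2l //; have -> : nb (twin e A [set b]) b = A.
    by apply/setP => y; rewrite !inE /twin inE eqxx.
  by rewrite cA; apply: deg_le.
apply: eq_leq; apply: eq_bigr => x xb; apply: eq_bigr => y yb.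
by rewrite /twin !inE (negbTE xb) (negbTE yb).
Qed.

(** A new triangle would need an edge inside [A]. An independent set with more than [s] elements
    would contain [b], and removing [b] would leave an s-set disjoint from [A] that misses [b]. *)
Lemma good_twin1 e s A b : good e s -> indep e A -> #|A| = s -> b \notin A ->
  (forall S, indep e S -> #|S| = s -> [disjoint S & A] -> b \in S) ->
  good (twin e A [set b]) s.
Proof.
move=> [sym tri ind] iA cA bA hb.
have symt : symmetric (twin e A [set b]).
  move=> x y; rewrite /twin !inE; case: eqP => [->|_].
    by case: eqP => [->|].
  by case: eqP => // _; rewrite sym.
split=> //.
- move=> x y z; rewrite /twin !inE.
  have AA u v : u \in A -> v \in A -> ~~ e u v by move/indepP: iA; apply.
  have Ab u : u \in A -> (u == b) = false.
    by move=> uA; apply: contraNF bA => /eqP <-.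
  case: (eqVneq x b) => [_|xb].
    move=> yA; rewrite (Ab y yA); case: (eqVneq z b) => [->|zb].
      by [].
    by move=> yz; apply/negP => zA; move: (AA _ _ yA zA); rewrite yz.
  case: (eqVneq y b) => [_ xA zA|yb]; first by rewrite (Ab z zA) AA.
  case: (eqVneq z b) => [_ xy yA|zb]; last exact: tri.
  by apply/negP => xA; move: (AA _ _ xA yA); rewrite xy.
- move=> S /indepP iS; rewrite leqNgt; apply/negP => cS.
  have indS' : indep e (S :\ b).
    apply/indepP => x y; rewrite !inE => /andP[xb xS] /andP[yb yS].
    by have := iS x y xS yS; rewrite /twin !inE (negbTE xb) (negbTE yb).
  have := cardsD1 b S; case bS: (b \in S) => /= h; have := ind _ indS'; last by cardlia.
  move=> h'; have cS' : #|S :\ b| = s by cardlia.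
  suff : b \in S :\ b by rewrite !inE eqxx.
  apply: hb => //.
  rewrite disjoint_subset; apply/subsetP => y; rewrite !inE => /andP[yb yS].
  by have := iS b y bS yS; rewrite /twin !inE eqxx.
Qed.

Lemma twin0 e A : twin e A set0 = e.
Proof. by apply/funext => x; apply/funext => y; rewrite /twin !inE. Qed.

Lemma twinU1 e A K b : [disjoint K & A] -> b \notin A ->
  twin (twin e A K) A [set b] = twin e A (b |: K).
Proof.
move=> dKA bA; apply/funext => x; apply/funext => y; rewrite /twin !inE.
by case: (eqVneq x b) => [_|xb] //=; case: (eqVneq y b) => [->|yb] //=;
  case: ifP => // xK; rewrite ?(disjointFr dKA xK) ?(negbTE bA).
Qed.

Lemma nb_twin_in e A K x : x \in K -> nb (twin e A K) x = A.
Proof. by move=> xK; apply/setP => y; rewrite in_nb /twin xK. Qed.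

Lemma nb_twin_notin e A K x : x \notin K ->
  nb (twin e A K) x = (if x \in A then K else set0) :|: (nb e x :\: K).
Proof.
move=> xK; apply/setP => y; rewrite !inE /twin (negbTE xK).
by case: (x \in A); case yK: (y \in K); rewrite ?inE ?yK ?orbF ?andbF.
Qed.

Lemma indep_twin e A K S : indep e S -> [disjoint S & A] -> indep (twin e A K) S.
Proof.
move=> /indepP iS dSA; apply/indepP => x y xS yS; rewrite /twin.
rewrite (disjointFr dSA xS) (disjointFr dSA yS).
by case: ifP => // _; case: ifP => // _; apply: iS.
Qed.

Lemma indep_twin_notin e A K S : indep e S -> [disjoint S & K] ->
  indep (twin e A K) S.
Proof.
move=> /indepP iS dSK; apply/indepP => x y xS yS; rewrite /twin.
by rewrite (disjointFr dSK xS) (disjointFr dSK yS) iS.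
Qed.

(* If every s-set disjoint from A contains Z, then [core_exists] applies outside A, K,
   Z and N. Otherwise it applies outside A and K: some s-set disjoint from A avoids Z,
   hence the vertex found is not in Z. *)
Lemma pick_core e s A K Z N D : good e s -> indep e A -> #|A| = s ->
  (forall k, k \in K -> nb e k = A) -> #|K| + #|T| < 3 * s ->
  indep e D -> #|D| = s -> [disjoint D & A] -> [disjoint D & N] ->
  (forall z, z \in Z -> nb e z = N) -> [disjoint Z & A] -> #|Z| <= #|N :\: A| ->
  exists b, [/\ b \notin A, b \notin K, b \notin Z &
    forall S, indep e S -> #|S| = s -> [disjoint S & A] -> b \in S].
Proof.
move=> ge iA cA nK cK iD cD dDA dDN nZ dZA cZ.
have sym := good_sym ge.
have subK S : indep e S -> #|S| = s -> [disjoint S & A] -> K \subset S.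
  move=> iS cS dSA; apply/subsetP => k kK.
  by apply: (max_indep_nb ge) => //; rewrite nK.
have KD : K \subset D by apply: subK.
have dKA : [disjoint K & A] := disjointWl KD dDA.
have iU U : [disjoint U & A] -> indep e U -> indep e (U :|: K).
  move=> dUA iU; apply: indepU => //.
    by apply: indep_sub iD.
  move=> x y xU yK; rewrite sym -in_nb nK //.
  by rewrite (disjointFr dUA xU).
have cAK : #|~: (A :|: K)| + s + #|K| = #|T|.
  have := cardsC (A :|: K); rewrite card_disjU 1?disjoint_sym //; cardlia.
have [[T0 [iT0 cT0 dT0A dT0Z]]|allZ] := pselect (exists T0 : {set T},
   [/\ indep e T0, #|T0| = s, [disjoint T0 & A] & [disjoint T0 & Z]]).
  (* Outside [A] nothing is adjacent to [K], so independent sets there extend by [K]; hence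
     [s - #|K|]. The size condition of [core_exists] is [#|K| + #|T| < 3 * s]. *)
  have [|||b bU hb] := @core_exists e (~: (A :|: K)) (s - #|K|) sym.
  - move=> S SU iS.
    have dSA : [disjoint S & A].
      by apply: disjointWl SU _; rewrite disjoint_sym disjoints_subset setCK subsetUl.
    have dSK : [disjoint S & K].
      by apply: disjointWl SU _; rewrite disjoint_sym disjoints_subset setCK subsetUr.
    have := good_ind ge (iU _ dSA iS); rewrite card_disjU //; cardlia.
  - exists (D :\: K); split.
    + apply/subsetP => x; rewrite !inE => /andP[xK xD].
      by rewrite (disjointFr dDA xD).
    + exact: indep_sub (subsetDl _ _) iD.
    + by have := cardsDI D K; rewrite (setIidPr KD); cardlia.
  - have := subset_leq_card KD; cardlia.
  have hb' S : indep e S -> #|S| = s -> [disjoint S & A] -> b \in S.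
    move=> iS cS dSA; have KS := subK S iS cS dSA.
    suff : b \in S :\: K by rewrite inE => /andP[].
    apply: hb.
    + apply/subsetP => x; rewrite !inE => /andP[xK xD].
      by rewrite (disjointFr dSA xD).
    + exact: indep_sub (subsetDl _ _) iS.
    + by have := cardsDI S K; rewrite (setIidPr KS); cardlia.
  exists b; move: bU; rewrite !inE negb_or => /andP[bA bK]; split=> //.
  by have := hb' T0 iT0 cT0 dT0A => /(disjointFr dT0Z) ->.
have dZN z : z \in Z -> z \notin N.
  by move=> zZ; rewrite -(nZ z zZ) (nb_notin ge).
have iZ : indep e Z.
  by apply/indepP => x y xZ yZ; rewrite -in_nb nZ // dZN.
(* The vertices of [Z] are twins, so an s-set meeting [Z] contains it, and hence avoids [N]. *)
have subZ S : indep e S -> #|S| = s -> [disjoint S & A] -> Z \subset S.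
  move=> iS cS dSA; apply/negPn/negP => nsub; apply: allZ; exists S; split=> //.
  rewrite disjoint_sym disjoint_subset; apply/subsetP => z zZ; rewrite !inE.
  apply/negP => zS; move/negP: nsub; apply; apply/subsetP => z' z'Z.
  apply: (max_indep_nb ge) => //; rewrite nZ // -(nZ z zZ).
  exact: indep_disj_nb iS zS.
have [z0 z0Z] : exists z0, z0 \in Z.
  apply/set0Pn/negP => /eqP Z0; apply: allZ; exists D; split=> //.
  by rewrite Z0 disjoints_subset setC0 subsetT.
have ZD : Z \subset D by apply: subZ.
have dKZ : [disjoint K & Z].
  rewrite disjoint_subset; apply/subsetP => k kK; rewrite !inE.
  apply/negP => kZ; have AN : A = N by rewrite -(nK k kK) nZ.
  by move: cZ; rewrite -AN setDv cards0 leqn0 cards_eq0 => /eqP Z0; rewrite Z0 inE in kZ.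
pose X := A :|: K :|: Z :|: N.
have cX : #|~: X| + s + #|K| + #|Z| + #|N :\: A| = #|T|.
  have -> : X = (A :|: K :|: Z) :|: (N :\: A).
    by apply/setP => x; rewrite !inE; case: (x \in A); rewrite ?orbT.
  have := cardsC (A :|: K :|: Z :|: (N :\: A)).
  rewrite card_disjU; last first.
    rewrite disjoint_subset; apply/subsetP => x; rewrite !inE.
    case/orP=> [/orP[->//|xK]|xZ].
      by rewrite (disjointFr dDN (subsetP KD _ xK)) andbF.
    by rewrite (negbTE (dZN x xZ)) andbF.
  rewrite card_disjU; last first.
    rewrite disjoint_subset; apply/subsetP => x; rewrite !inE.
    case/orP=> [xA|xK]; first by rewrite (disjointFl dZA xA).
    by rewrite (disjointFr dKZ xK).
  rewrite card_disjU 1?disjoint_sym //; cardlia.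
have inX x : x \in ~: X -> [/\ x \notin A, x \notin K, x \notin Z & x \notin N].
  by rewrite !inE !negb_or => /andP[/andP[/andP[-> ->] ->] ->].
have cDZ S : indep e S -> #|S| = s -> [disjoint S & A] ->
    [/\ S :\: (K :|: Z) \subset ~: X, indep e (S :\: (K :|: Z)) &
        #|S :\: (K :|: Z)| = s - #|K| - #|Z|].
  move=> iS cS dSA; split.
  - apply/subsetP => x; rewrite !inE !negb_or => /andP[/andP[xK xZ] xS].
    rewrite (disjointFr dSA xS) xK xZ /=.
    have /(disjointFr (indep_disj_nb iS (subsetP (subZ S iS cS dSA) _ z0Z))) := xS.
    by rewrite nZ // => ->.
  - exact: indep_sub (subsetDl _ _) iS.
  - have := cardsDI S (K :|: Z); rewrite (setIidPr _) ?subUset ?subK ?subZ //.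
    rewrite card_disjU //; cardlia.
(* Here [a] drops by [#|Z|], so [2 * a] drops by [2 * #|Z|]; the set [~: X] loses
   [#|Z| + #|N :\: A|], which is at least as much. *)
have [|||b bU hb] := @core_exists e (~: X) (s - #|K| - #|Z|) sym.
- move=> S SU iS.
  have dSA : [disjoint S & A].
    by rewrite disjoint_subset; apply/subsetP => x /(subsetP SU)/inX[]; rewrite !inE.
  have dSKZ : [disjoint S & K :|: Z].
    rewrite disjoint_subset; apply/subsetP => x /(subsetP SU)/inX[].
    by rewrite !inE negb_or => _ -> ->.
  have : indep e ((S :|: K) :|: Z).
    apply: indepU => //; first exact: iU.
    move=> x y xSK yZ; rewrite sym -in_nb nZ //.
    move: xSK; rewrite inE => /orP[/(subsetP SU)/inX[]//|xK].
    by rewrite (disjointFr dDN (subsetP KD _ xK)).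
  rewrite -setUA => /(good_ind ge); rewrite card_disjU // card_disjU //; cardlia.
- by exists (D :\: (K :|: Z)); apply: cDZ.
- have : #|K :|: Z| <= #|D| by apply: subset_leq_card; rewrite subUset KD ZD.
  rewrite card_disjU //; cardlia.
have [bA bK bZ _] := inX b bU.
exists b; split=> // S iS cS dSA.
have [h1 h2 h3] := cDZ S iS cS dSA.
by have := hb _ h1 h2 h3; rewrite inE => /andP[].
Qed.

(** Iterates [pick_core], which applies as long as [#|K| + #|T| < 3 * s]. The pair [Z], [N] protects
    an earlier twin class: [K] avoids [Z], and [K \subset D] avoids [N], so the neighbourhoods of
    [Z] do not change. *)
Lemma twin_many e s A Z N D p : good e s -> indep e A -> #|A| = s ->
  p + #|T| <= 3 * s ->
  indep e D -> #|D| = s -> [disjoint D & A] -> [disjoint D & N] ->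
  (forall z, z \in Z -> nb e z = N) -> [disjoint Z & A] -> #|Z| <= #|N :\: A| ->
  exists K, [/\ #|K| = p, [disjoint K & Z], good (twin e A K) s,
    vol e <= vol (twin e A K) &
    forall S, indep e S -> #|S| = s -> [disjoint S & A] -> K \subset S].
Proof.
move=> ge iA cA + iD cD dDA dDN nZ dZA cZ; elim: p => [_|p IH hp].
  exists set0; rewrite cards0 twin0; split=> //.
    by rewrite disjoints_subset sub0set.
  by move=> S; rewrite sub0set.
have [|K [cK dKZ gK vK subK]] := IH; first by cardlia.
have KD : K \subset D by apply: subK.
have dKA : [disjoint K & A] := disjointWl KD dDA.
have iA' : indep (twin e A K) A by apply: indep_twin_notin; rewrite // disjoint_sym.
have [|z zZ|b [bA bK bZ hb]] := @pick_core (twin e A K) s A K Z N D gK iA' cA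
  (fun k => @nb_twin_in e A K k) _ (indep_twin K iD dDA) cD dDA dDN _ dZA cZ.
- by cardlia.
- rewrite nb_twin_notin; last by rewrite (disjointFl dKZ zZ).
  rewrite (disjointFr dZA zZ) set0U nZ //; apply/setDidPl.
  by rewrite disjoint_sym; apply: disjointWl KD dDN.
exists (b |: K); split.
- by rewrite cardsU1 bK cK.
- rewrite disjoint_subset; apply/subsetP => x; rewrite !inE.
  by case/orP => [/eqP->//|xK]; rewrite (disjointFr dKZ xK).
- by rewrite -twinU1 //; apply: good_twin1.
- apply: leq_trans vK _; rewrite -twinU1 //; exact: vol_le_twin1 gK cA bA.
- move=> S iS cS dSA; rewrite subUset sub1set subK // andbT.
  by apply: hb => //; apply: indep_twin.
Qed.

(** While no s-set is disjoint from [A], the condition of [good_twin1] holds vacuously, so any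
    vertex of [W] can be converted. If all of [W] gets converted, the last hypothesis supplies the
    s-set. *)
Lemma twin_until_disjoint e s A W : good e s -> indep e A -> #|A| = s ->
  [disjoint W & A] ->
  (exists S, [/\ indep (twin e A W) S, #|S| = s & [disjoint S & A]]) ->
  exists K S, [/\ K \subset W, good (twin e A K) s, vol e <= vol (twin e A K) &
    [/\ indep (twin e A K) S, #|S| = s & [disjoint S & A]]].
Proof.
move=> ge iA cA dWA hW.
suff H m : forall K, K \subset W -> good (twin e A K) s ->
    vol e <= vol (twin e A K) -> #|W :\: K| = m ->
    exists K S, [/\ K \subset W, good (twin e A K) s, vol e <= vol (twin e A K) &
      [/\ indep (twin e A K) S, #|S| = s & [disjoint S & A]]].
  by apply: (H _ set0) => //; rewrite ?sub0set ?twin0.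
elim: m => [|m IH] K KW gK vK.
  move/eqP; rewrite cards_eq0 setD_eq0 => WK.
  have KWe : K = W by apply/eqP; rewrite eqEsubset KW.
  by have [S hS] := hW; exists K, S; split=> //; rewrite KWe.
move=> cWK.
have [[S hS]|noS] := pselect (exists S, [/\ indep (twin e A K) S, #|S| = s & [disjoint S & A]]).
  by exists K, S.
have [b] : exists b, b \in W :\: K by apply/set0Pn; rewrite -cards_eq0 cWK.
rewrite inE => /andP[bK bW].
have bA : b \notin A by rewrite (disjointFr dWA bW).
have dKA : [disjoint K & A] := disjointWl KW dWA.
have iA' : indep (twin e A K) A by apply: indep_twin_notin; rewrite // disjoint_sym.
apply: (IH (b |: K)).
- by rewrite subUset sub1set bW.
- rewrite -twinU1 //; apply: good_twin1 => // S iS cS dSA.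
  by case: noS; exists S.
- apply: leq_trans vK _; rewrite -twinU1 //; exact: vol_le_twin1 gK cA bA.
- have := cardsD1 b (W :\: K); rewrite inE bK bW cWK /= add1n => -[->].
  by congr #|pred_of_set _|; apply/setP => x; rewrite !inE negb_or andbA.
Qed.

(** * Four twin classes on a path *)

(** Counts ordered pairs, so an edge inside [A] counts twice in [edges e A A]. *)
Definition edges e A B : nat := \sum_(x in A) #|nb e x :&: B|.

Lemma edgesC e A B : symmetric e -> edges e A B = edges e B A.
Proof.
move=> sym.
have E A' B' : edges e A' B' = \sum_(x in A') \sum_(y in B') (e x y : nat).
  apply: eq_bigr => x _; rewrite -sum1_card big_mkcond [RHS]big_mkcond /=.
  by apply: eq_bigr => y _; rewrite !inE andbC; case: (y \in B'); case: (e x y).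
rewrite !E exchange_big /=; apply: eq_bigr => y _; apply: eq_bigr => x _.
by rewrite sym.
Qed.

Lemma edgesDr e A B D : edges e A D = edges e A (D :&: B) + edges e A (D :\: B).
Proof.
rewrite /edges -big_split /=; apply: eq_bigr => x _.
by rewrite (cardsDI (nb e x :&: D) B) setIA setIDA.
Qed.

Lemma edgesUl e A B D : [disjoint A & B] ->
  edges e (A :|: B) D = edges e A D + edges e B D.
Proof. by move=> d; rewrite /edges -bigU //; apply: eq_bigl => x; rewrite !inE. Qed.

Lemma edges_nb e A B N : (forall x, x \in A -> nb e x = N) ->
  edges e A B = #|A| * #|N :&: B|.
Proof.
move=> h; rewrite /edges (eq_bigr (fun=> #|N :&: B|)) ?sum_nat_const //.
by move=> x /h->.
Qed.

Lemma edges_le e A B k : (forall x, x \in A -> #|nb e x :&: B| <= k) ->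
  edges e A B <= #|A| * k.
Proof. by move=> h; rewrite -sum_nat_const; apply: leq_sum. Qed.

(* k is the independence number of Om; edges inside Om are counted from their
   endpoints outside a maximum independent set. *)
Lemma edges_indep_bound e s (Om : {set T}) : good e s -> exists k t,
  [/\ #|Om| = k + t, edges e Om Om <= 2 * (k * t) &
      forall x, #|nb e x :&: Om| <= k].
Proof.
move=> ge; have sym := good_sym ge.
pose P S := (S \subset Om) && indep e S.
have P0 : P set0.
  by rewrite /P sub0set; apply/indepP => x y; rewrite inE.
have [I /andP[IO iI] mx] : exists2 I, P I & forall S, P S -> #|S| <= #|I|.
  by case: (arg_maxnP (fun S => #|S|) P0) => I PI mx; exists I.
have hk x : #|nb e x :&: Om| <= #|I|.
  apply: mx; rewrite /P subsetIr.
  by apply: indep_sub (subsetIl _ _) (indep_nb ge x).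
exists #|I|, #|Om :\: I|; split=> //.
  by rewrite (cardsDI Om I) (setIidPr IO).
rewrite (edgesDr e Om I) (setIidPr IO) edgesC //.
have -> : edges e I Om = edges e (Om :\: I) I.
  rewrite (edgesDr e I I) (setIidPr IO).
  have -> : edges e I I = 0.
    rewrite /edges big1 // => x xI; apply/eqP; rewrite cards_eq0 setI_eq0.
    by rewrite disjoint_sym; apply: indep_disj_nb iI xI.
  by rewrite add0n edgesC.
have h1 : edges e (Om :\: I) I <= edges e (Om :\: I) Om.
  by apply: leq_sum => x _; apply/subset_leq_card/setIS.
have h2 : edges e (Om :\: I) Om <= #|Om :\: I| * #|I| by apply: edges_le.
have h3 : edges e Om (Om :\: I) = edges e (Om :\: I) Om by rewrite edgesC.
rewrite h3 mul2n -addnn mulnC; apply: leq_add => //.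
exact: leq_trans h1 h2.
Qed.

(* The twin classes form a path B1 - B0 - B4 - B3. Since N0 is disjoint from N1 and
   N4, and N4 from N3, a vertex outside the classes lies in at most two of the four
   neighbourhoods; R2 collects those lying in exactly two. *)
Lemma path_count e s p q B1 B0 B4 B3 N1 N0 N4 N3 :
  good e s -> s = 2 * p + q -> #|T| = 5 * p + 3 * q -> q <= p ->
  (forall b, b \in B1 -> nb e b = N1) -> (forall b, b \in B0 -> nb e b = N0) ->
  (forall b, b \in B4 -> nb e b = N4) -> (forall b, b \in B3 -> nb e b = N3) ->
  [/\ #|B1| = p, #|B0| = p, #|B4| = p & #|B3| = p] ->
  [/\ #|N0| = s, #|N4| = s & #|N3| = s] ->
  [/\ [disjoint N1 & N0], [disjoint N0 & N4] & [disjoint N4 & N3]] ->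
  [/\ B0 \subset N1, B0 \subset N4 & B3 \subset N4] ->
  [/\ B1 \subset N0, B4 \subset N0 & B4 \subset N3] ->
  [disjoint B1 & N3] -> [disjoint B3 & N1] ->
  vol e <= 10 * p * p + 10 * p * q + 4 * q * q.
Proof.
move=> ge es eT qp n1 n0 n4 n3 [c1 c0 c4 c3] [cN0 cN4 cN3] [d10 d04 d43].
move=> [s01 s04 s34] [s10 s40 s43] dB1N3 dB3N1.
have sym := good_sym ge.
have dB14 : [disjoint B1 & B4] by apply: disjointWr s43 dB1N3.
have dB03 : [disjoint B0 & B3] by apply: disjointWl s01 _; rewrite disjoint_sym.
have d14_03 : [disjoint B1 :|: B4 & B0 :|: B3].
  by apply: (disjointW (B := N0) (D := N4)) d04; rewrite subUset ?s10 ?s40 ?s04 ?s34.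
pose U := (B1 :|: B4) :|: (B0 :|: B3).
have edgeU X : edges e U X =
    p * (#|N1 :&: X| + #|N4 :&: X| + #|N0 :&: X| + #|N3 :&: X|).
  rewrite /U !edgesUl // (edges_nb _ n1) (edges_nb _ n0) (edges_nb _ n4) (edges_nb _ n3).
  rewrite c1 c0 c4 c3; cardlia.
pose R := ~: U.
have cU : #|U| = 4 * p by rewrite /U !card_disjU // c1 c0 c4 c3; cardlia.
have cR : #|R| = p + 3 * q by have := cardsC U; rewrite cU eT /R; cardlia.
have notin N N' x : [disjoint N & N'] -> x \in N -> x \in N' = false.
  by move=> d xN; rewrite (disjointFr d xN).
have U1 : N1 :&: U = B0.
  apply/setP => x; rewrite !inE; apply/andP/idP => [[xN1]|xB]; last first.
    by rewrite (subsetP s01) // xB !orbT.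
  case/orP => /orP[xB|xB] //.
  - by have := subsetP s10 _ xB; rewrite (notin _ _ _ d10 xN1).
  - by have := subsetP s40 _ xB; rewrite (notin _ _ _ d10 xN1).
  - by rewrite (disjointFr dB3N1 xB) in xN1.
have U0 : N0 :&: U = B1 :|: B4.
  apply/setP => x; rewrite !inE; apply/andP/orP => [[xN0]|[xB|xB]].
  - case/orP => /orP[xB|xB]; [by left|by right| |].
      by have := subsetP s04 _ xB; rewrite (notin _ _ _ d04 xN0).
    by have := subsetP s34 _ xB; rewrite (notin _ _ _ d04 xN0).
  - by rewrite (subsetP s10) // xB.
  - by rewrite (subsetP s40) // xB orbT.
have U4 : N4 :&: U = B0 :|: B3.
  apply/setP => x; rewrite !inE; apply/andP/orP => [[xN4]|[xB|xB]].
  - case/orP => /orP[xB|xB]; [| |by left|by right].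
      by have := notin _ _ _ d04 (subsetP s10 _ xB); rewrite xN4.
    by have := notin _ _ _ d04 (subsetP s40 _ xB); rewrite xN4.
  - by rewrite (subsetP s04) // xB orbT.
  - by rewrite (subsetP s34) // xB !orbT.
have U3 : N3 :&: U = B4.
  apply/setP => x; rewrite !inE; apply/andP/idP => [[xN3]|xB]; last first.
    by rewrite (subsetP s43) // xB !orbT.
  case/orP => /orP[xB|xB] //.
  - by rewrite (disjointFr dB1N3 xB) in xN3.
  - by have := notin _ _ _ d43 (subsetP s04 _ xB); rewrite xN3.
  - by have := notin _ _ _ d43 (subsetP s34 _ xB); rewrite xN3.
have cRN N : #|N| = #|N :&: U| + #|N :&: R|.
  by rewrite (cardsDI N U) setDE.
have edgeUU : edges e U U = 6 * p * p.
  by rewrite edgeU U1 U0 U4 U3 !card_disjU // c1 c0 c4 c3; cardlia.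
(* The deficiency of [N1] removes [2 * p * phi] from the pairs meeting [B1], which offsets the same
   term in [path_arith]. *)
pose phi := s - #|N1|.
(* The degree bound on [N1] needs a vertex of [B1]. If [p = 0], then [q = 0] and the graph is
   empty. *)
have [N1s|N1s] : #|N1| <= s /\ 0 < p \/ p = 0.
- case: (posnP p) => [|p0]; [by right|left; split=> //].
  have /card_gt0P[b bB1] : 0 < #|B1| by rewrite c1.
  by rewrite -(n1 b bB1); apply: deg_le.
- have phiE : phi + #|N1| = s by rewrite subnK //; case: N1s.
  move: (cRN N1) (cRN N0) (cRN N4) (cRN N3).
  rewrite U1 U0 U4 U3 !card_disjU // c1 c0 c4 c3 cN0 cN4 cN3 => r1 r0 r4 r3.
  pose f x := (x \in N1) + (x \in N4) + (x \in N0) + (x \in N3).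
  have f2 x : f x <= 2.
    rewrite /f; case x0: (x \in N0).
      have -> : x \in N1 = false by rewrite (disjointFl d10 x0).
      by rewrite (disjointFr d04 x0); case: (x \in N3).
    case x4: (x \in N4).
      by rewrite (disjointFr d43 x4); case: (x \in N1).
    by case: (x \in N1); case: (x \in N3).
  have sumR N : \sum_(x in R) (x \in N : nat) = #|N :&: R|.
    rewrite -sum1_card big_mkcond [RHS]big_mkcond; apply: eq_bigr => x _ /=.
    by rewrite in_setI andbC; case: (x \in R); case: (x \in N).
  have sumf : \sum_(x in R) f x = #|N1 :&: R| + #|N4 :&: R| + #|N0 :&: R| + #|N3 :&: R|.
    by rewrite /f !big_split /= !sumR.
  pose R2 := [set x in R | f x == 2].
  have R2R : R2 \subset R by apply/subsetP => x; rewrite inE => /andP[].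
  pose Om := R :\: R2.
  have cR2 : #|R| = #|R2| + #|Om| by rewrite (cardsDI R R2) (setIidPr R2R).
  have dR2Om : [disjoint R2 & Om].
    by rewrite disjoint_sym disjoints_subset /Om setDE subsetIr.
  have URO : R2 :|: Om = R by rewrite -[RHS](setID R R2) (setIidPr R2R).
  have sumf_le : \sum_(x in R) f x <= 2 * #|R2| + #|Om|.
    have -> : \sum_(x in R) f x = \sum_(x in R2) f x + \sum_(x in Om) f x.
      by rewrite -bigU //; apply: eq_bigl => x; rewrite -URO in_setU.
    apply: leq_add.
      by rewrite mulnC -sum_nat_const; apply: leq_sum.
    rewrite -sum1_card; apply: leq_sum => x; rewrite in_setD in_set.
    by move=> /andP[h xR]; rewrite xR /= in h; have := f2 x; rewrite leq_eqVlt (negbTE h).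
  have [k [t [cOm eOm hk]]] := edges_indep_bound Om ge.
  have nbU x : #|nb e x :&: U| = p * f x.
    have nbB B N : (forall b, b \in B -> nb e b = N) -> #|B| = p ->
        #|nb e x :&: B| = p * (x \in N).
      move=> nB cB; case xN: (x \in N); rewrite ?muln1 ?muln0.
        rewrite -cB; congr #|pred_of_set _|; apply/setIidPr/subsetP => b bB.
        by rewrite in_nb sym -in_nb (nB b bB).
      apply/eqP; rewrite cards_eq0 setI_eq0 disjoint_sym disjoint_subset.
      apply/subsetP => b bB; rewrite !inE sym -in_nb (nB b bB) xN //.
    rewrite /U !setIUr !card_disjU.
    - by rewrite (nbB _ _ n1) // (nbB _ _ n4) // (nbB _ _ n0) // (nbB _ _ n3) // /f; cardlia.
    - by apply: disjointW dB03; apply: subsetIr.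
    - by apply: disjointW dB14; apply: subsetIr.
    - by rewrite -!setIUr; apply: disjointW d14_03; apply: subsetIr.
  (* Such an [x] has [2 * p] neighbours in [U], hence at most [q] others, of which at most
     [minn k q] lie in [Om]. These count twice because pairs between [R2] and [Om] occur in both
     orders. *)
  have degR2 x : x \in R2 -> #|nb e x :&: R2| + 2 * #|nb e x :&: Om| <= q + minn k q.
    rewrite inE => /andP[xR /eqP fx]; have := nbU x; rewrite fx.
    have := deg_le ge x; have := hk x.
    rewrite (cardsDI (nb e x) U).
    have -> : nb e x :\: U = (nb e x :&: R2) :|: (nb e x :&: Om).
      by rewrite -setIUr URO setDE.
    rewrite card_disjU; last by apply: disjointW dR2Om; apply: subsetIr.
    cardlia.
  have eRR : edges e R R <= #|R2| * (q + minn k q) + 2 * (k * t).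
    rewrite -{1}URO edgesUl // (edgesDr e R2 R2 R) (edgesDr e Om R2 R).
    rewrite (setIidPr R2R) -/Om (edgesC Om R2 sym).
    have : edges e R2 R2 + 2 * edges e R2 Om <= #|R2| * (q + minn k q).
      rewrite -sum_nat_const /edges big_distrr -big_split /=.
      exact: leq_sum.
    cardlia.
  (* The sum of [f] over [R] is [2 * p + 4 * q - phi], so [sumf_le] gives [#|Om| <= 2 * q + phi]. *)
  have arith : edges e R R <= 2 * p * q + 4 * q * q + 2 * p * phi.
    apply: leq_trans eRR _; apply: (@path_arith p q #|R2| #|Om| k t phi) => //; cardlia.
  have volE : vol e = edges e U setT + edges e R setT.
    rewrite -edgesUl; last by rewrite disjoints_subset setCK.
    rewrite setUCr; rewrite /edges /vol; apply: eq_big => x; rewrite ?inE //.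
    by rewrite setIT.
  have eUT : edges e U setT = edges e U U + edges e U R.
    by rewrite (edgesDr e U U setT) setTI setTD.
  have eRT : edges e R setT = edges e U R + edges e R R.
    by rewrite (edgesDr e R U setT) setTI setTD (edgesC R U).
  have : edges e U setT = p * (#|N1| + 3 * s).
    by rewrite edgeU !setIT cN0 cN4 cN3; congr (_ * _); cardlia.
  have : p * #|N1| + p * phi = p * s by rewrite -mulnDr; congr (_ * _); rewrite addnC.
  have : p * s = 2 * p * p + p * q by rewrite es mulnDr; cardlia.
  rewrite mulnDr; cardlia.
have := vol_le ge; rewrite eT es N1s; have -> : q = 0 by cardlia.
by rewrite !muln0.
Qed.

Lemma nb_twin_keep e A K N x : nb e x = N -> x \notin K ->
  (if x \in A then K \subset N else [disjoint N & K]) -> nb (twin e A K) x = N.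
Proof.
move=> nx xK; rewrite nb_twin_notin // nx; case: (x \in A).
  by move=> KN; rewrite -[RHS](setID N K) (setIidPr KN).
by rewrite set0U => /setDidPl.
Qed.

(** First [B4] becomes a twin class with neighbourhood [Sw]; it lies in both [S0] and [S3], which
    are disjoint from [Sw]. Then [B3] gets the neighbourhood [S3], with [B0] as the protected class.
    [B1] is not protected and may lose neighbours, whence [S1 :\: B3] in the role of [N1]. *)
Lemma path_structure e s p q S0 S1 S3 Sw B0 B1 :
  good e s -> s = 2 * p + q -> #|T| = 5 * p + 3 * q -> q < p ->
  [/\ indep e S0, indep e S3 & indep e Sw] ->
  [/\ #|S0| = s, #|S3| = s & #|Sw| = s] ->
  (forall b, b \in B0 -> nb e b = S0) -> (forall b, b \in B1 -> nb e b = S1) ->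
  #|B0| = p -> #|B1| = p -> B0 \subset S1 -> B1 \subset S0 ->
  [disjoint S0 & S1] -> [disjoint B0 & S3] -> [disjoint B1 & S3] ->
  [disjoint Sw & S3] -> [disjoint Sw & S0] ->
  vol e <= 10 * p * p + 10 * p * q + 4 * q * q.
Proof.
move=> ge es eT qp [i0 i3 iw] [c0 c3 cw] n0 n1 cB0 cB1 B0S1 B1S0 d01 dB03 dB13 dw3 dw0.
have B0w : B0 \subset Sw.
  by apply/subsetP => b bB; apply: (max_indep_nb ge) => //; rewrite n0.
have dB00 : [disjoint B0 & S0] := disjointWl B0w dw0.
have [||||||B4 [cB4 _ ge5 v5 subB4]] := @twin_many e s Sw set0 set0 S3 p ge iw cw _ i3 c3.
- cardlia.
- by rewrite disjoint_sym.
- by rewrite disjoints_subset setC0 subsetT.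
- by move=> z; rewrite inE.
- by rewrite disjoints_subset sub0set.
- by rewrite cards0.
have B4S0 : B4 \subset S0 by apply: subB4; rewrite // disjoint_sym.
have B4S3 : B4 \subset S3 by apply: subB4; rewrite // disjoint_sym.
set e5 := twin e Sw B4 in ge5 v5.
have n04 b : b \in B0 -> nb e5 b = S0.
  move=> bB; apply: nb_twin_keep; rewrite ?n0 //.
    by apply/negP => /(subsetP B4S0); rewrite (disjointFr dB00 bB).
  by rewrite (subsetP B0w).
have n14 b : b \in B1 -> nb e5 b = S1.
  move=> bB; apply: nb_twin_keep; rewrite ?n1 //.
    by apply/negP => /(subsetP B4S3); rewrite (disjointFr dB13 bB).
  rewrite (disjointFl dw0 (subsetP B1S0 _ bB)).
  by rewrite disjoint_sym; apply: disjointWl B4S0 d01.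
have n4 b : b \in B4 -> nb e5 b = Sw by apply: nb_twin_in.
have i35 : indep e5 S3 by apply: indep_twin; rewrite // disjoint_sym.
have iw5 : indep e5 Sw.
  by apply: indep_twin_notin => //; apply: disjointWr B4S0 dw0.
have [||||||B3 [cB3 dB3 ge6 v6 subB3]] := @twin_many e5 s S3 B0 S0 Sw p ge5 i35 c3 _ iw5 cw.
- cardlia.
- exact: dw3.
- exact: dw0.
- exact: n04.
- exact: dB03.
- rewrite cB0 -cB1; apply/subset_leq_card; rewrite subsetD B1S0 //.
have B3w : B3 \subset Sw by apply: subB3.
apply: leq_trans v5 _; apply: leq_trans v6 _.
have d4_3 b : b \in B4 -> b \notin B3.
  by move=> bB; apply/negP => /(subsetP B3w); rewrite (disjointFl dw3) ?(subsetP B4S3).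
apply: (@path_count _ s p q B1 B0 B4 B3 (S1 :\: B3) S0 Sw S3) => //.
- exact: ltnW.
- move=> b bB; have bB3 : b \notin B3.
    by apply/negP => /(subsetP B3w); rewrite (disjointFl dw0) ?(subsetP B1S0).
  by rewrite nb_twin_notin // n14 // (disjointFr dB13 bB) set0U.
- move=> b bB; apply: nb_twin_keep; rewrite ?n04 ?(disjointFl dB3 bB) //.
  rewrite (disjointFr dB03 bB) disjoint_sym; exact: disjointWl B3w dw0.
- move=> b bB; apply: nb_twin_keep; rewrite ?n4 ?d4_3 //.
  by rewrite (subsetP B4S3).
- exact: nb_twin_in.
- split=> //; last by rewrite disjoint_sym.
  by rewrite disjoint_sym; apply: disjointWr (subsetDl _ _) d01.
- split=> //; rewrite subsetD B0S1 /=; by rewrite disjoint_sym.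
- by rewrite disjoint_sym disjoints_subset setDE subsetIr.
Qed.

Lemma deleted_edge_or_bound e s p q A : good e s -> s = 2 * p + q ->
  #|T| = 5 * p + 3 * q -> q < p -> indep e A -> #|A| = s ->
  vol e <= 10 * p * p + 10 * p * q + 4 * q * q \/
  exists e' b0 b1, [/\ good e' s, vol e <= vol e', e' b0 b1 &
    forall S, indep e' S -> #|S| = s -> b0 \in S \/ b1 \in S].
Proof.
move=> ge es eT qp; set S0 := A => i0 c0.
(* If everything outside [S0] is converted, any [s] of the [3 * p + 2 * q] vertices there are
   independent. *)
have [||K1 [S1 [K1A ge1 v1 [i1 c1 d10]]]] := @twin_until_disjoint e s S0 (~: S0) ge i0 c0.
- by rewrite disjoints_subset.
- have [|S SA cS] := @subset_of_card (~: S0) s.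
    by have := cardsC S0; rewrite c0 eT; cardlia.
  exists S; split=> //; last by rewrite disjoints_subset.
  apply/indepP => x y /(subsetP SA) xS /(subsetP SA) yS.
  by rewrite /twin xS; rewrite inE in yS.
set e1 := twin e S0 K1 in ge1 v1 i1.
have i01 : indep e1 S0.
  apply: indep_twin_notin => //; rewrite disjoint_sym disjoints_subset //.
have d0 (X : {set T}) : [disjoint X & (set0 : {set T})].
  by rewrite disjoints_subset setC0 subsetT.
have triv f z : z \in set0 -> nb f z = set0 by rewrite inE.
have [|||B0 [cB0 _ ge2 v2 subB0]] := @twin_many e1 s S0 set0 set0 S1 p ge1 i01 c0 _
  i1 c1 d10 (d0 _) (@triv _).
- cardlia.
- by rewrite disjoint_sym d0.
- by rewrite cards0.
have B0S1 : B0 \subset S1 by apply: subB0.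
set e2 := twin e1 S0 B0 in ge2 v2.
have i02 : indep e2 S0.
  by apply: indep_twin_notin; rewrite // disjoint_sym; apply: disjointWl B0S1 _.
have i12 : indep e2 S1 by apply: indep_twin.
have d01 : [disjoint S0 & S1] by rewrite disjoint_sym.
have [|||B1 [cB1 _ ge3 v3 subB1]] := @twin_many e2 s S1 set0 set0 S0 p ge2 i12 c1 _
  i02 c0 d01 (d0 _) (@triv _).
- cardlia.
- by rewrite disjoint_sym d0.
- by rewrite cards0.
have B1S0 : B1 \subset S0 by apply: subB1.
set e3 := twin e2 S1 B1 in ge3 v3.
have dB0B1 : [disjoint B0 & B1] by apply: disjointW B0S1 B1S0 _.
have n03 b : b \in B0 -> nb e3 b = S0.
  move=> bB; apply: nb_twin_keep; rewrite ?(disjointFr dB0B1 bB) //.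
    exact: nb_twin_in.
  by rewrite (subsetP B0S1).
have n13 b : b \in B1 -> nb e3 b = S1 by apply: nb_twin_in.
have i03 : indep e3 S0 by apply: indep_twin.
have i13 : indep e3 S1.
  by apply: indep_twin_notin; rewrite // disjoint_sym; apply: disjointWl B1S0 _.
have v03 : vol e <= vol e3 by apply: leq_trans v1 (leq_trans v2 v3).
have /card_gt0P[b0 b0B] : 0 < #|B0| by rewrite cB0; cardlia.
have /card_gt0P[b1 b1B] : 0 < #|B1| by rewrite cB1; cardlia.
have [allS|] := pselect (forall S, indep e3 S -> #|S| = s -> b0 \in S \/ b1 \in S).
  right; exists e3, b0, b1; split=> //.
  by rewrite -in_nb n03 // (subsetP B1S0).
move=> /existsNP[S3 /not_implyP[i3 /not_implyP[c3 /not_orP[/negP nb0 /negP nb1]]]].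
left; apply: leq_trans v03 _.
(* An s-set containing one vertex of a twin class contains the whole class. *)
have avoid B N b : (forall b, b \in B -> nb e3 b = N) -> b \in B -> b \notin S3 ->
    [disjoint B & S3].
  move=> nB bB bS; rewrite disjoint_subset; apply/subsetP => x xB; rewrite !inE.
  apply: contraNN bS => xS; apply: (max_indep_nb ge3) => //.
  by rewrite nB // -(nB x xB); apply: indep_disj_nb i3 xS.
have dB03 : [disjoint B0 & S3] by exact: (avoid _ _ _ n03 b0B nb0).
have dB13 : [disjoint B1 & S3] by exact: (avoid _ _ _ n13 b1B nb1).
(* The neighbours of [B1] form [S1], so exchange in [S3] applies. It follows that at least
   [#|T| - 2 * s + p = s] vertices lie outside [S1 :|: S3]. *)
have c13 : p <= #|S1 :&: S3|.
  have := hall_swap ge3 i3 c3 (indep_sub B1S0 i03) dB13.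
  rewrite cB1 => h; apply: leq_trans h _; apply/subset_leq_card.
  apply/subsetP => y; rewrite !inE => /andP[-> /exists_inP[x xB xy]].
  by rewrite andbT -(n13 x xB) in_nb.
(* Converting only [W] preserves [S0], [S1], [S3] as s-sets and the neighbourhoods of [B0] and [B1].
   With all of [W] converted, the complement of [S1 :|: S3] is independent: it consists of [W] and a
   part of [S0]. *)
pose W := ~: (S0 :|: S1 :|: S3).
have [||K4 [Sw [K4W ge4 v4 [iw cw dw3]]]] := @twin_until_disjoint e3 s S3 W ge3 i3 c3.
- by rewrite disjoints_subset setCS subsetUr.
- have [|S SQ cS] := @subset_of_card (~: (S1 :|: S3)) s.
    have := cardsC (S1 :|: S3); have := cardsU S1 S3; rewrite c1 c3 eT; cardlia.
  exists S; split=> //; last first.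
    by rewrite disjoints_subset; apply: subset_trans SQ _; rewrite setCS subsetUr.
  apply/indepP => x y /(subsetP SQ) xS /(subsetP SQ) yS.
  have h z : z \in ~: (S1 :|: S3) -> (z \notin S3) /\ (z \notin W -> z \in S0).
    rewrite !inE negb_or => /andP[z1 z3]; split=> //.
    by rewrite negbK (negbTE z1) (negbTE z3) !orbF.
  have [x3 xW] := h x xS; have [y3 yW] := h y yS; rewrite /twin.
  case: ifPn => [_|/xW x0]; first exact: y3.
  case: ifPn => [_|/yW y0]; first exact: x3.
  by move/indepP: i03; apply.
set e4 := twin e3 S3 K4 in ge4 v4 iw.
have dK4 (X : {set T}) : X \subset S0 :|: S1 :|: S3 -> [disjoint X & K4].
  move=> sX; apply: (disjointW sX K4W).
  by rewrite disjoints_subset /W setCK.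
have dS0 : [disjoint S0 & K4] by apply: dK4; rewrite -setUA subsetUl.
have dS1 : [disjoint S1 & K4] by apply: dK4; rewrite (setUC S0) -setUA subsetUl.
have dS3 : [disjoint S3 & K4] by apply: dK4; rewrite subsetUr.
have n04 b : b \in B0 -> nb e4 b = S0.
  move=> bB; apply: nb_twin_keep; rewrite ?n03 //.
    by rewrite (disjointFr dS1 (subsetP B0S1 _ bB)).
  by rewrite (disjointFr dB03 bB).
have n14 b : b \in B1 -> nb e4 b = S1.
  move=> bB; apply: nb_twin_keep; rewrite ?n13 //.
    by rewrite (disjointFr dS0 (subsetP B1S0 _ bB)).
  by rewrite (disjointFr dB13 bB).
have i04 : indep e4 S0 by apply: indep_twin_notin.
have i14 : indep e4 S1 by apply: indep_twin_notin.
have i34 : indep e4 S3 by apply: indep_twin_notin.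
apply: leq_trans v4 _.
(* Since [2 * p + 2 * s = 6 * p + 2 * q] exceeds [#|T|] and [S3] avoids both classes, [Sw] meets one
   of them. It is then disjoint from the neighbourhood of that class. *)
have [b bB] : exists b, b \in (B0 :|: B1) :&: Sw.
  apply/set0Pn; rewrite setI_eq0; apply/negP => dB.
  have : #|(B0 :|: B1) :|: (Sw :|: S3)| <= #|T| by apply: max_card.
  rewrite card_disjU.
    by rewrite card_disjU // card_disjU // cB0 cB1 cw c3 eT; cardlia.
  rewrite disjoints_subset subUset.
  apply/andP; split; apply/subsetP => x xB; rewrite !inE negb_or.
    by rewrite (disjointFr dB03 xB) andbT (disjointFr dB) // inE xB.
  by rewrite (disjointFr dB13 xB) andbT (disjointFr dB) // inE xB orbT.
move: bB; rewrite !inE => /andP[/orP[bB|bB] bw].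
- apply: (@path_structure e4 s p q S0 S1 S3 Sw B0 B1) => //.
  by rewrite -(n04 b bB); apply: indep_disj_nb iw bw.
- apply: (@path_structure e4 s p q S1 S0 S3 Sw B1 B0) => //.
  by rewrite -(n14 b bB); apply: indep_disj_nb iw bw.
Qed.

(** * Deleting the ends of an edge, and the induction *)

Lemma vol_edges e W : symmetric e ->
  vol e + edges e W W = 2 * edges e W setT + edges e (~: W) (~: W).
Proof.
move=> sym.
have -> : vol e = edges e W setT + edges e (~: W) setT.
  rewrite -edgesUl; last by rewrite disjoints_subset setCK.
  rewrite setUCr; rewrite /edges /vol; apply: eq_big => x; rewrite ?inE //.
  by rewrite setIT.
have h : edges e W setT = edges e W W + edges e W (~: W).
  by rewrite (edgesDr e W W setT) setTI setTD.
have -> : edges e (~: W) setT = edges e W (~: W) + edges e (~: W) (~: W).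
  by rewrite (edgesDr e (~: W) W setT) setTI setTD (edgesC (~: W) W).
by rewrite h; cardlia.
Qed.

End Graphs.

Lemma good_restrict (T : finType) (e : rel T) s (W : {set T}) : good e s ->
  (forall S : {set T}, indep e S -> S \subset W -> #|S| < s) ->
  good (fun x y : {x | x \in W} => e (val x) (val y)) s.-1.
Proof.
move=> [sym tri ind] hW; split=> [x y|x y z|S /indepP iS]; [exact: sym|exact: tri|].
have := hW (val @: S); rewrite card_imset; last exact: val_inj.
suff -> : indep e (val @: S).
  have -> : val @: S \subset W by apply/subsetP => _ /imsetP[x _ ->]; apply: valP.
  by move=> /(_ isT isT) h; rewrite -ltnS (ltn_predK h).
by apply/indepP => _ _ /imsetP[x xS ->] /imsetP[y yS ->]; apply: iS.
Qed.

Lemma vol_restrict (T : finType) (e : rel T) (W : {set T}) :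
  vol (fun x y : {x | x \in W} => e (val x) (val y)) = edges e W W.
Proof.
rewrite /vol /edges [RHS]big_sub; apply: eq_bigr => x _.
rewrite -(card_imset _ val_inj); congr #|pred_of_set _|; apply/setP => y.
rewrite !inE; apply/imsetP/andP => [[z]|[xy yW]]; first by rewrite inE => ? ->; split=> //; apply: valP.
by exists (Sub y yW); rewrite ?inE ?SubK.
Qed.

Lemma vol_delete_edge (T : finType) (e : rel T) s b0 b1 : good e s -> e b0 b1 ->
  (forall S : {set T}, indep e S -> #|S| = s -> b0 \in S \/ b1 \in S) ->
  exists (T' : finType) (e' : rel T'),
    [/\ #|T'| + 2 = #|T|, good e' s.-1 & vol e + 2 <= 4 * s + vol e'].
Proof.
move=> ge eb hb; have sym := good_sym ge; pose W := ~: [set b0; b1].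
have nb01 : b0 != b1 by apply/eqP => h; rewrite h (good_irr ge) in eb.
have c2 : #|[set b0; b1]| = 2 by rewrite cards2 nb01.
exists {x | x \in W}, (fun x y => e (val x) (val y)); split.
- have -> : #|{: {x | x \in W}}| = #|W| by rewrite card_sig; apply: eq_card.
  by have := cardsC [set b0; b1]; rewrite c2 addnC.
- apply: good_restrict => // S iS SW; rewrite ltn_neqAle (good_ind ge) // andbT.
  apply/eqP => /(hb S iS)[] /(subsetP SW); rewrite !inE eqxx ?orbT //.
rewrite vol_restrict; have := vol_edges [set b0; b1] sym; rewrite -/W.
have : edges e [set b0; b1] setT <= 2 * s.
  by rewrite -c2; apply: edges_le => x _; rewrite setIT; apply: deg_le.
suff : 2 <= edges e [set b0; b1] [set b0; b1] by cardlia.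
rewrite /edges big_setU1 ?inE //= big_set1.
have h x y : e x y -> y \in [set b0; b1] -> 0 < #|nb e x :&: [set b0; b1]|.
  by move=> xy yb; apply/card_gt0P; exists y; rewrite !inE xy; rewrite !inE in yb.
have h0 : 0 < #|nb e b0 :&: [set b0; b1]| by apply: (h b0 b1); rewrite // !inE eqxx orbT.
have h1 : 0 < #|nb e b1 :&: [set b0; b1]| by apply: (h b1 b0); rewrite 1?sym // !inE eqxx.
by apply: (leq_add h0 h1).
Qed.

Theorem triangle_free_vol_le p q (T : finType) (e : rel T) :
  #|T| = 5 * p + 3 * q -> good e (2 * p + q) ->
  vol e <= 10 * p * p + 10 * p * q + 4 * q * q.
Proof.
elim/ltn_ind: p q T e => p IH q T e eT ge.
have [pq|qp] := leqP p q.
  (* The degree bound minus the target is [q * (p - q)], which is not positive. *)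
  have := vol_le ge; rewrite eT.
  have : p * p <= p * q by rewrite leq_mul2l pq orbT.
  have : p * q <= q * q by rewrite leq_mul2r pq orbT.
  by clear; nia.
have [[A [iA cA]]|noA] := pselect (exists A : {set T}, indep e A /\ #|A| = 2 * p + q).
  have [//|[e' [b0 [b1 [ge' vv' eb hb]]]]] :=
    deleted_edge_or_bound ge erefl eT qp iA cA.
  (* Deleting both ends of the edge replaces (p, q) by (p - 1, q + 1). *)
  have [T2 [e2 [cT2 ge2 v2]]] := vol_delete_edge ge' eb hb.
  have [h ph] : exists h, p = (q + h).+1 by exists (p - q).-1; cardlia.
  have cT2' : #|T2| = 5 * (q + h) + 3 * q.+1 by cardlia.
  have ge2' : good e2 (2 * (q + h) + q.+1).
    by have -> : 2 * (q + h) + q.+1 = (2 * p + q).-1 by cardlia.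
  have := IH (q + h) _ q.+1 _ e2 cT2' ge2'; rewrite ph leqnn => /(_ isT).
  (* The target drops by [10 * p + 2 * q - 4], which is at least the loss
     [4 * s - 2 = 8 * p + 4 * q - 2] because [q < p]. *)
  by move: v2 vv'; rewrite ph; clear; nia.
have ge1 : good e (2 * p + q).-1.
  have [sym tri ind] := ge; split=> // S iS.
  have := ind S iS; rewrite leq_eqVlt => /orP[/eqP cS|]; last by cardlia.
  by case: noA; exists S.
have [h ph] : exists h, p = (q + h).+1 by exists (p - q).-1; cardlia.
(* Without s-sets, s can be decreased, which replaces (p, q) by (p - 3, q + 5). *)
have [h3|h3] := ltnP h 3.
  have := vol_le ge1; rewrite eT ph; move: h3; clear => h3.
  have -> : (2 * (q + h).+1 + q).-1 = 3 * q + 2 * h + 1 by lia.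
  have : h = 0 \/ h = 1 \/ h = 2 by lia.
  by case=> [->|[->|->]]; nia.
have := IH (p - 3) _ (q + 5) T e.
have -> : 2 * (p - 3) + (q + 5) = (2 * p + q).-1 by cardlia.
have -> : 5 * (p - 3) + 3 * (q + 5) = 5 * p + 3 * q by cardlia.
move=> /(_ ltac:(cardlia) eT ge1).
have [g hg] : exists g, h = g + 3 by exists (h - 3); cardlia.
have -> : p - 3 = q + g + 1 by cardlia.
(* The target drops by [10 * (p - q - 4) = 10 * g]; this is why [h < 3] was treated by degrees. *)
by rewrite ph hg; clear; nia.
Qed.

(** * Passing between edge sets and adjacency relations *)

Section EdgeSets.
Variable T : finType.
Implicit Types (E : {set {set T}}) (e : rel T).

Lemma adj_sym E : symmetric (adj E).
Proof. by move=> x y; rewrite /adj setUC. Qed.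

Lemma adj_good E s : triangle_free E -> independence_number E <= s ->
  good (adj E) s.
Proof.
move=> /existsPn tf /bigmax_leqP al; split; first exact: adj_sym.
  move=> x y z xy yz; apply/negP => xz.
  have /existsPn/(_ y)/existsPn/(_ z) := tf x.
  by rewrite xy yz xz.
by move=> S iS; apply: al.
Qed.

Lemma vol_adj E : is_graph E -> vol (adj E) = 2 * #|E|.
Proof.
move=> /forall_inP gE.
have nbE x : #|nb (adj E) x| = \sum_(A in E | x \in A) 1.
  have inj : injective (fun y => [set x; y]).
    move=> y z /setP h; have := h y; rewrite !inE eqxx orbT => /esym/orP[/eqP yx|/eqP //].
    by have := h z; rewrite yx !inE orbb eqxx orbT => /eqP.
  rewrite -(card_imset _ inj) -sum1_card; apply: eq_bigl => A.
  apply/imsetP/andP => [[y]|[AE xA]].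
    by rewrite in_nb /adj => xy ->; rewrite xy !inE eqxx.
  have cA := eqP (gE A AE).
  have /cards1P[y Ay] : #|A :\ x| == 1 by have := cardsD1 x A; rewrite cA xA add1n => -[<-].
  have AxE : A = [set x; y] by rewrite -(setD1K xA) Ay.
  by exists y; rewrite ?inE /adj -?AxE.
rewrite /vol (eq_bigr _ (fun x _ => nbE x)) (exchange_big_dep (mem E)) /=; last first.
  by move=> x A _ /andP[].
rewrite mulnC -sum_nat_const; apply: eq_bigr => A AE.
rewrite -[RHS](eqP (gE A AE)) -[RHS]sum1_card.
by apply: eq_bigl => x; rewrite AE.
Qed.

Lemma good_edge_set e s : good e s -> exists E, [/\ is_graph E, triangle_free E,
  independence_number E <= s & vol e = 2 * #|E|].
Proof.
move=> ge; have [sym tri ind] := ge.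
pose E := [set A : {set T} | [exists x, exists y, e x y && (A == [set x; y])]].
have adjE : adj E = e.
  apply/funext => x; apply/funext => y; rewrite /adj inE.
  apply/existsP/idP => [[u /existsP[v /andP[uv /eqP/setP h]]]|xy]; last first.
    by exists x; apply/existsP; exists y; rewrite xy eqxx.
  have := h x; rewrite !inE eqxx /= => /esym/orP[/eqP xu|/eqP xv].
    have := h v; rewrite !inE eqxx orbT => /orP[/eqP vx|/eqP <-]; last by rewrite xu.
    by move: uv; rewrite vx xu (good_irr ge).
  have := h u; rewrite !inE eqxx => /orP[/eqP ux|/eqP <-]; last by rewrite xv sym.
  by move: uv; rewrite ux xv (good_irr ge).
have gE : is_graph E.
  apply/forall_inP => A; rewrite inE => /existsP[x /existsP[y /andP[xy /eqP->]]].
  by rewrite cards2; case: (eqVneq x y) xy => [->|] //; rewrite (good_irr ge).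
exists E; split=> //.
- apply/existsPn => x; apply/existsPn => y; apply/existsPn => z; rewrite adjE.
  by apply/and3P => -[xy yz xz]; move/negP: (tri _ _ _ xy yz).
- by apply/bigmax_leqP => A; rewrite /independent adjE => /ind.
- by rewrite -vol_adj // adjE.
Qed.

End EdgeSets.

Lemma ex_vol_le n s M : (forall e : rel 'I_n, good e s -> vol e <= 2 * M) ->
  ex n s <= M.
Proof.
move=> h; apply/bigmax_leqP => E /and3P[gE tE iE].
by have := h _ (adj_good tE iE); rewrite vol_adj // leq_pmul2l.
Qed.

Lemma vol_le_ex n s (e : rel 'I_n) : good e s -> vol e <= 2 * ex n s.
Proof.
move=> /good_edge_set[E [gE tE iE ->]]; rewrite leq_pmul2l //.
by apply: (leq_bigmax_cond (F := fun E : {set {set 'I_n}} => #|E|)); apply/and3P.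
Qed.

Lemma ex_upper p q : ex (5 * p + 3 * q) (2 * p + q) <= 5 * p * p + 5 * p * q + 2 * q * q.
Proof.
apply: ex_vol_le => e /(triangle_free_vol_le (card_ord _)); lia.
Qed.

Lemma ex_degree_bound n s : 2 * ex n s <= n * s.
Proof.
suff : ex n s <= (n * s)./2 by lia.
apply/bigmax_leqP => E /and3P[gE tE iE].
by have := vol_le (adj_good tE iE); rewrite vol_adj // card_ord; lia.
Qed.

(** * Blow-ups of Andrasfai graphs *)

Section Blowup.
Variables (k : nat) (w : nat -> nat) (g : rel nat).

(** Position [x] holds the class of vertex [x], so the blow-up lives on an ordinal, as [ex]
    requires. *)
Definition blowup_colors : seq nat := flatten [seq nseq (w i) i | i <- iota 0 k].

Lemma sum_blowup_colors (F : nat -> nat) :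
  \sum_(x < size blowup_colors) F (nth 0 blowup_colors x) = \sum_(0 <= i < k) w i * F i.
Proof.
rewrite -(big_mkord xpredT (fun x => F (nth 0 blowup_colors x))) -(big_nth 0 xpredT F).
rewrite big_flatten big_map /index_iota subn0; apply: eq_bigr => i _.
by rewrite big_nseq iter_addn_0 mulnC.
Qed.

Lemma size_blowup_colors : size blowup_colors = \sum_(0 <= i < k) w i.
Proof.
rewrite -[LHS]card_ord -sum1_card (sum_blowup_colors (fun=> 1)).
by apply: eq_bigr => i _; rewrite muln1.
Qed.

Lemma blowup_colors_lt (x : 'I_(size blowup_colors)) : nth 0 blowup_colors x < k.
Proof.
have : nth 0 blowup_colors x \in blowup_colors by rewrite mem_nth.
by move=> /flattenP[_ /mapP[i + ->]]; rewrite mem_iota => ik /nseqP[-> _].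
Qed.

Definition symmetric_triangle_free : bool :=
  all (fun i => all (fun j => (g i j == g j i) &&
    all (fun l => [==> g i j, g j l => ~~ g i l]) (iota 0 k)) (iota 0 k)) (iota 0 k).

Lemma symmetric_triangle_freeP : symmetric_triangle_free ->
  forall i j, i < k -> j < k ->
    g i j = g j i /\ forall l, l < k -> g i j -> g j l -> ~~ g i l.
Proof.
move=> /allP h i j ik jk; have := h i; rewrite mem_iota => /(_ ik)/allP/(_ j).
rewrite mem_iota => /(_ jk)/andP[/eqP gij /allP hl]; split=> // l lk ij jl.
by have := hl l; rewrite mem_iota ij jl => /(_ lk).
Qed.

(** The classes met by an independent set of the blow-up form an independent set [P] of [g], whose
    total weight bounds its size. *)
Lemma blowup_le_ex s : symmetric_triangle_free ->
  (forall P : pred nat, (forall i j, i < k -> j < k -> P i -> P j -> ~~ g i j) ->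
    \sum_(0 <= i < k) w i * P i <= s) ->
  \sum_(0 <= i < k) w i * \sum_(0 <= j < k) w j * g i j <=
    2 * ex (\sum_(0 <= i < k) w i) s.
Proof.
move=> /symmetric_triangle_freeP gP ind; pose c (x : 'I_(size blowup_colors)) := nth 0 blowup_colors x.
have clt x : c x < k := blowup_colors_lt x.
have ge : good (fun x y => g (c x) (c y)) s.
  split=> [x y|x y z|S /indepP iS].
  - by case: (gP _ _ (clt x) (clt y)).
  - by case: (gP _ _ (clt x) (clt y)) => _; apply.
  pose P i := [exists x in S, c x == i].
  apply: leq_trans (ind P _); last first.
    move=> i j _ _ /exists_inP[x xS /eqP<-] /exists_inP[y yS /eqP<-].
    exact: iS.
  rewrite -(sum_blowup_colors (fun i => P i)) -sum1_card big_mkcond /=.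
  apply: leq_sum => x _; case: ifP => // xS.
  by rewrite lt0b; apply/exists_inP; exists x => //; apply: eqxx.
rewrite -size_blowup_colors; apply: leq_trans (vol_le_ex ge).
rewrite -(sum_blowup_colors (fun i => \sum_(0 <= j < k) w j * g i j)) /vol.
apply: eq_leq; apply: eq_bigr => x _.
rewrite -(sum_blowup_colors (fun j => g (c x) j)).
have -> : #|nb (fun x y => g (c x) (c y)) x| = \sum_y g (c x) (c y).
  by rewrite -sum1_card big_mkcond; apply: eq_bigr => y _; rewrite in_nb; case: (g _ _).
by [].
Qed.

End Blowup.

(** * Independent sets of small graphs by enumeration *)

Fixpoint all_bits n (f : seq bool -> bool) : bool :=
  if n is n'.+1 then
    all_bits n' (fun b => f (true :: b)) && all_bits n' (fun b => f (false :: b))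
  else f [::].

Lemma all_bitsP n f : all_bits n f -> forall b, size b = n -> f b.
Proof.
elim: n f => [f fn [|] //|n IH f /= /andP[h1 h2] [|[] b] //= [cb]].
  exact: (IH _ h1).
exact: (IH _ h2).
Qed.

Definition independent_bits (g : rel nat) (b : seq bool) : bool :=
  all (fun i => all (fun j => ~~ [&& nth false b i, nth false b j & g i j])
    (iota 0 (size b))) (iota 0 (size b)).

Lemma independent_bitsP (g : rel nat) k (P : pred nat) :
  (forall i j, i < k -> j < k -> P i -> P j -> ~~ g i j) ->
  independent_bits g (mkseq P k).
Proof.
move=> h; apply/allP => i; rewrite mem_iota size_mkseq => /andP[_ ik].
apply/allP => j; rewrite mem_iota => /andP[_ jk]; rewrite !nth_mkseq //.
by apply/and3P => -[Pi Pj gij]; have := h i j ik jk Pi Pj; rewrite gij.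
Qed.

(* Adjacency at circular distance at least d modulo n; for n = 3 d - 1 this is
   the Andrasfai graph. *)
Definition andrasfai n d : rel nat := fun i j => d <= (i + n - j) %% n <= n - d.

Lemma wagner_independent (P : pred nat) :
  (forall i j, i < 8 -> j < 8 -> P i -> P j -> ~~ andrasfai 8 3 i j) ->
  exists2 i, i < 8 & forall j, j < 8 -> P j -> (j + 8 - i) %% 8 < 3.
Proof.
move=> /independent_bitsP iP.
pose f b := independent_bits (andrasfai 8 3) b ==>
  has (fun i => all (fun j => nth false b j ==> ((j + 8 - i) %% 8 < 3)) (iota 0 8)) (iota 0 8).
have /all_bitsP/(_ (mkseq P 8)) : all_bits 8 f by vm_compute.
rewrite size_mkseq => /(_ erefl) /implyP /(_ iP) /hasP[i].
rewrite mem_iota => /andP[_ i8] /allP h; exists i => // j j8 Pj.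
by have := h j; rewrite mem_iota nth_mkseq // Pj => /(_ j8).
Qed.

(* The weights put the five classes p and the three classes q on the Wagner graph
   so that every window of three consecutive classes weighs at most 2 p + q. *)
Lemma ex_lower p q : q <= p ->
  5 * p * p + 5 * p * q + 2 * q * q <= ex (5 * p + 3 * q) (2 * p + q).
Proof.
move=> qp; pose w := nth 0 [:: p; p; q; p; p; q; p; q].
have := @blowup_le_ex 8 w (andrasfai 8 3) (2 * p + q).
have -> : \sum_(0 <= i < 8) w i = 5 * p + 3 * q by rewrite unlock /w /=; lia.
move=> h; rewrite -(leq_pmul2l (isT : 0 < 2)); apply: leq_trans (h _ _).
- by apply: eq_leq; rewrite unlock /w /=; nia.
- by vm_compute.
- move=> P /wagner_independent[i i8 hP].
  have P0 x : x < 8 -> 3 <= (x + 8 - i) %% 8 -> P x = false.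
    move=> x8; rewrite leqNgt => /negP nx; case Px: (P x) => //.
    by case: nx; apply: hP.
  rewrite unlock /w /=; clear -qp i8 P0.
  case: i i8 P0 => [|[|[|[|[|[|[|[|//]]]]]]]] _ P0;
    (try rewrite (P0 0 isT isT); try rewrite (P0 1 isT isT);
    try rewrite (P0 2 isT isT); try rewrite (P0 3 isT isT);
    try rewrite (P0 4 isT isT); try rewrite (P0 5 isT isT);
    try rewrite (P0 6 isT isT); try rewrite (P0 7 isT isT)); clear P0;
    repeat (match goal with |- context [P ?x] => case: (P x) end); clear -qp; lia.
Qed.

Lemma independent_sum_le k g a (P : pred nat) :
  all_bits k (fun b => independent_bits g b ==> (count id b <= a)) ->
  (forall i j, i < k -> j < k -> P i -> P j -> ~~ g i j) ->
  \sum_(0 <= i < k) P i <= a.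
Proof.
move=> /all_bitsP/(_ (mkseq P k)) + /independent_bitsP iP.
rewrite size_mkseq => /(_ erefl)/implyP/(_ iP).
by rewrite count_map -sum1_count big_mkcond /index_iota subn0.
Qed.

(* The second graph has independence ratio 4/11 < 3/8; a bounded number of copies of
   it absorbs the residue of n modulo 8 when s is the integer part of 3 n / 8. *)
Lemma ex_lower_union m c : 12 * m * m <= ex (8 * m + 11 * c) (3 * m + 4 * c).
Proof.
pose w i := if i < 8 then m else c.
pose g i j := if i < 8 then (j < 8) && andrasfai 8 3 i j
  else (8 <= j) && andrasfai 11 4 (i - 8) (j - 8).
have := @blowup_le_ex 19 w g (3 * m + 4 * c).
have -> : \sum_(0 <= i < 19) w i = 8 * m + 11 * c by rewrite unlock /w /=; lia.
move=> h; rewrite -(leq_pmul2l (isT : 0 < 2)); apply: leq_trans (h _ _).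
- by rewrite unlock /w /g /=; nia.
- by vm_compute.
- move=> P iP.
  have P1 : \sum_(0 <= i < 8) P i <= 3.
    apply: (@independent_sum_le 8 (andrasfai 8 3)) => [|i j i8 j8 Pi Pj].
      by vm_compute.
    by have := iP i j; rewrite /g i8 j8 => -> //; apply: ltn_trans (isT : 8 < 19).
  have P2 : \sum_(0 <= i < 11) P (i + 8) <= 4.
    apply: (@independent_sum_le 11 (andrasfai 11 4)) => [|i j i11 j11 Pi Pj].
      by vm_compute.
    have : g (i + 8) (j + 8) = andrasfai 11 4 i j.
      by rewrite /g ltnNge [8 <= i + 8]leq_addl [8 <= j + 8]leq_addl /= !addnK.
    by move=> <-; apply: iP; rewrite // (@ltn_add2r 8 _ 11).
  rewrite (big_cat_nat (n := 8)) //= -{2}[8]add0n big_addn.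
  rewrite (eq_big_nat _ _ (F2 := fun i => m * P i)); last by move=> i /andP[_ i8]; rewrite /w i8.
  rewrite [X in _ + X](eq_bigr (fun i => c * P (i + 8))); last first.
    by move=> i _; rewrite /w ltnNge [8 <= _]leq_addl.
  rewrite -!big_distrr /= [3 * m]mulnC [4 * c]mulnC; exact: leq_add (leq_mul _ P1) (leq_mul _ P2).
Qed.

Lemma ex_monotone n s t : s <= t -> ex n s <= ex n t.
Proof.
move=> st; apply: ex_vol_le => e [sym tri ind]; apply: vol_le_ex; split=> // S iS.
exact: leq_trans (ind S iS) st.
Qed.

From mathcomp Require Import all_order all_algebra.
From mathcomp Require Import all_classical all_reals all_analysis.
From mathcomp Require Import ring lra zify.
Import Order.TTheory GRing.Theory Num.Theory.
Import numFieldNormedType.Exports.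
Local Open Scope ring_scope.
Local Open Scope classical_set_scope.

(** * The formula and the limit *)

Lemma ex_formula (R : realType) (n s : nat) :
  3 / 8 * n%:R <= s%:R :> R -> s%:R <= 2 / 5 * n%:R :> R ->
  (ex n s)%:R = 3 * n%:R ^+ 2 - 15 * n%:R * s%:R + 20 * s%:R ^+ 2 :> R.
Proof.
move=> h1 h2.
have le1 : (3 * n <= 8 * s)%N by rewrite -(ler_nat R) !natrM; lra.
have le2 : (5 * s <= 2 * n)%N by rewrite -(ler_nat R) !natrM; lra.
have [p [q [nE sE qp]]] :
    exists p q, [/\ n = 5 * p + 3 * q, s = 2 * p + q & q <= p]%N.
  by exists (3 * s - n)%N, (2 * n - 5 * s)%N; split; lia.
have -> : ex n s = (5 * p * p + 5 * p * q + 2 * q * q)%N.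
  by rewrite nE sE; apply/eqP; rewrite eqn_leq ex_upper ex_lower.
by rewrite nE sE !natrD !natrM; ring.
Qed.

Lemma ex_lower_three_eighths (R : realType) (n : nat) : (200 <= n)%N ->
  3 / 16 * n%:R ^+ 2 - 100 * n%:R <= (ex n (Num.truncn (3 / 8 * n%:R : R)))%:R :> R.
Proof.
move=> n200.
have [m [c [nE c8 c15]]] : exists m c, [/\ n = 8 * m + 11 * c, 8 <= c & c < 16]%N.
  (* Modulo 8, [11 * c] is [3 * c] and 3 is its own inverse, so [c] must be congruent to [3 * n].
     From [c <= 15] and [n >= 200] it follows that [11 * c <= n]. *)
  pose c := (8 + (3 * n) %% 8)%N.
  by exists ((n - 11 * c) %/ 8)%N, c; rewrite /c; split; lia.
have c8R : 8 <= c%:R :> R by rewrite ler_nat.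
have c15R : c%:R <= 16 :> R by rewrite ler_nat; lia.
have nER : n%:R = 8 * m%:R + 11 * c%:R :> R by rewrite nE natrD !natrM.
have sle : (3 * m + 4 * c <= Num.truncn (3 / 8 * n%:R : R))%N.
  rewrite truncn_ge_nat; last by rewrite mulr_ge0 ?ler0n //; lra.
  by rewrite natrD !natrM; lra.
have : (12 * m * m <= ex n (Num.truncn (3 / 8 * n%:R : R)))%N.
  by apply: leq_trans (ex_monotone n sle); rewrite {1}nE ex_lower_union.
rewrite -(ler_nat R) !natrM; apply: le_trans.
have m0 : 0 <= m%:R :> R by rewrite ler0n.
by rewrite nER; nra.
Qed.

Lemma ex_estimate (R : realType) (a : R) : 3 / 8 <= a <= 2 / 5 ->
  \forall n \near \oo,
    `|(ex n (Num.truncn (a * n%:R)))%:R - (3 - 15 * a + 20 * a ^+ 2) * n%:R ^+ 2|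
      <= 100 * n%:R.
Proof.
move=> /andP[a1 a2].
have [aE|a3] := eqVneq a (3 / 8).
  near=> n; have n200 : (200 <= n)%N by near: n; exact: nbhs_infty_ge.
  have := ex_lower_three_eighths R n200; rewrite aE.
  set s := Num.truncn _ => lo.
  have := ex_degree_bound n s; rewrite -(ler_nat R) !natrM => up.
  have sn : s%:R <= 3 / 8 * n%:R :> R by rewrite truncn_le mulr_ge0 ?ler0n //; lra.
  have n0 : 0 <= n%:R :> R by rewrite ler0n.
  have := ler_wpM2l n0 sn; rewrite ler_norml; nra.
have a4 : 3 / 8 < a by rewrite lt_neqAle eq_sym a3.
near=> n.
have n0 : 0 <= n%:R :> R by rewrite ler0n.
(* Truncation loses less than 1, so this keeps [s] above [3 / 8 * n]. *)
have nbig : 1 <= (a - 3 / 8) * n%:R.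
  rewrite mulrC -ler_pdivrMr ?subr_gt0 //; near: n; exact: nbhs_infty_ger.
have := @truncn_itv R (a * n%:R); rewrite mulr_ge0 //; last lra.
move=> /(_ isT); set s := Num.truncn _ => /andP[s1 s2].
rewrite -natr1 in s2.
have san := ler_wpM2r n0 a2.
rewrite ex_formula; [|lra|lra].
have n1 : 1 <= n%:R :> R.
  by rewrite ler1n lt0n; apply: contraTneq nbig => ->; rewrite mulr0 ler10.
(* The rounding error [t] lies between 0 and 1, and [40 * a - 15] does too, so the deviation is
   linear in [n]. *)
pose t := a * n%:R - s%:R; have -> : s%:R = a * n%:R - t by rewrite /t; ring.
have t0 : 0 <= t by rewrite /t; lra.
have t1 : t <= 1 by rewrite /t; lra.
have -> : 3 * n%:R ^+ 2 - 15 * n%:R * (a * n%:R - t) + 20 * (a * n%:R - t) ^+ 2 -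
    (3 - 15 * a + 20 * a ^+ 2) * n%:R ^+ 2 = 20 * t ^+ 2 - (40 * a - 15) * (t * n%:R).
  by ring.
have tn0 : 0 <= t * n%:R by rewrite mulr_ge0.
have tn1 : t * n%:R <= n%:R by rewrite ler_piMl.
have tt1 : t ^+ 2 <= 1 by rewrite expr_le1.
have tt0 : 0 <= t ^+ 2 by rewrite sqr_ge0.
have u0 : 0 <= (40 * a - 15) * (t * n%:R) by rewrite mulr_ge0 //; lra.
have u1 : (40 * a - 15) * (t * n%:R) <= t * n%:R by rewrite ler_piMl //; lra.
by rewrite ler_norml; apply/andP; split; lra.
Unshelve. all: by end_near.
Qed.

Lemma RT_ratio_cvg (R : realType) (a : R) : 3 / 8 <= a <= 2 / 5 ->
  RT_ratio a @ \oo --> (6 - 30 * a + 40 * a ^+ 2 : R).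
Proof.
move=> aI; apply/cvgrPdist_le => eps eps0; near=> n.
have n2 : (1 < n)%N by near: n; exact: nbhs_infty_ge.
have n2R : 2 <= n%:R :> R by rewrite ler_nat.
(* The numerator will differ from the limit times the binomial by [d + c * n], at most [101 * n] in
   absolute value; doubling matches [2 * 'C(n, 2) = n * (n - 1)]. *)
have epsn : 202 <= eps * (n%:R - 1).
  rewrite mulrC -ler_pdivrMr // lerBrDr; near: n; exact: nbhs_infty_ger.
rewrite distrC; have : `|(ex n (Num.truncn (a * n%:R)))%:R - (3 - 15 * a + 20 * a ^+ 2) * n%:R ^+ 2|
    <= 100 * n%:R by near: n; exact: ex_estimate.
rewrite /RT_ratio; set c := 3 - _ + _; set x := (ex _ _)%:R.
set d := x - _ => dn; have -> : x = d + c * n%:R ^+ 2 by rewrite /d; ring.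
have c01 : 0 <= c <= 1 by have [a1 a2] := andP aI; rewrite /c; apply/andP; split; nra.
have binE : 2 * 'C(n, 2)%:R = n%:R * (n%:R - 1) :> R.
  by rewrite -natrM -mul_bin_diag bin1 natrM -subn1 natrB // ltnW.
have bin0 : 0 < 'C(n, 2)%:R :> R by rewrite ltr0n bin_gt0.
rewrite -(ler_pM2r bin0) -[X in _ * X <= _](gtr0_norm bin0) -normrM mulrBl divfK ?gt_eqF //.
have -> : d + c * n%:R ^+ 2 - (6 - 30 * a + 40 * a ^+ 2) * 'C(n, 2)%:R = d + c * n%:R.
  have -> : 6 - 30 * a + 40 * a ^+ 2 = c * 2 by rewrite /c; ring.
  by rewrite -mulrA binE; ring.
apply: le_trans (ler_normD _ _) _; move/andP: c01 => [c0 c1].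
have cn : c * n%:R <= n%:R by rewrite ler_piMl // ler0n.
rewrite [`|c * _|]ger0_norm ?mulr_ge0 //.
have : 202 * n%:R <= eps * (2 * 'C(n, 2)%:R).
  by rewrite binE [n%:R * _]mulrC mulrA ler_wpM2r.
move: dn cn; lra.
Unshelve. all: by end_near.
Qed.

Theorem theorem1p2 (R : realType) :
  (forall n s : nat,
      3 / 8 * n%:R <= s%:R :> R ->
      s%:R <= 2 / 5 * n%:R :> R ->
      (ex n s)%:R = 3 * n%:R ^+ 2 - 15 * n%:R * s%:R + 20 * s%:R ^+ 2 :> R)
  /\
  (forall a : R, 3 / 8 <= a <= 2 / 5 ->
      cvgn (RT_ratio a) /\ RT_density a = 6 - 30 * a + 40 * a ^+ 2).
Proof.
split=> [n s|a /RT_ratio_cvg ca]; first exact: ex_formula.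
by split; [apply/cvg_ex; eexists; exact: ca|exact: cvg_lim ca].
Qed.
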